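(* Let $\zeta_H\in\Theta_H$ be a coarse representation of white noise with coarse coefficient vector $\boldsymbol{\zeta}_H\sim\mathcal N(0,W_H^{-1})$, and let $\zeta_h\in\Theta_h$ be a fine representation of white noise with fine coefficient vector $\boldsymbol{\zeta}_h\sim\mathcal N(0,W_h^{-1})$, such that $\boldsymbol{\zeta}_H$ and $\boldsymbol{\zeta}_h$ are independent. Then the fine-level function $$\zeta'_h=\zeta_H+(I-\mathcal Q_H)\,\zeta_h$$ is a representation of white noise in $\Theta_h$; that is, the coefficient vector of $\zeta'_h$ in the basis of $\Theta_h$ has distribution $\mathcal N(0,W_h^{-1})$.
   Context: Let $D\subset\mathbb R^d$, $d=2$ or $3$, be a bounded spatial domain, and let $(\cdot,\cdot)$ denote the $L^2(D)$ inner product. $\mathcal T_h$ and $\mathcal T_H$ are a fine and a coarse triangulation of $D$, and $\Theta_h,\Theta_H\subset L^2(D)$ are the corresponding finite-dimensional spaces of functions piecewise constant on the elements, with $\Theta_H\subset\Theta_h$. For $\bullet\in\{h,H\}$, $\Theta_\bullet$ carries an $L^2$-orthogonal basis $\{\chi_\tau\}_{\tau\in\mathcal T_\bullet}$ of piecewise constants ($\chi_\tau$ is a nonzero constant on the element $\tau$ and vanishes outside $\tau$). Its mass matrix is $W_\bullet=\big((\chi_{\tau_i},\chi_{\tau_j})\big)_{\tau_i,\tau_j\in\mathcal T_\bullet}$, diagonal and positive definite. The coarse (resp. fine) coefficient vector of an element of $\Theta_H$ (resp. $\Theta_h$) is the vector of its coordinates in the basis of $\Theta_H$ (resp. $\Theta_h$).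 $\mathcal Q_H:L^2(D)\to\Theta_H$ is the $L^2$-orthogonal projection, and $I$ is the identity. White noise $\zeta$ on $D$ is the generalized Gaussian random field with $\langle\zeta,v\rangle\sim\mathcal N(0,\|v\|_{L^2(D)}^2)$ for all $v\in L^2(D)$ (so $\mathbb E[\langle\zeta,v\rangle\langle\zeta,w\rangle]=(v,w)$). A random element $\zeta_\bullet$ of $\Theta_\bullet$ is called a representation of white noise in $\Theta_\bullet$ if the Gaussian vector $\big((\zeta_\bullet,\chi_\tau)\big)_{\tau\in\mathcal T_\bullet}$ has mean $0$ and covariance matrix $W_\bullet$; equivalently, its coefficient vector has distribution $\mathcal N(0,W_\bullet^{-1})$. *)

(* Defs.v *)
From HB Require Import structures.
From mathcomp Require Import all_boot all_order all_algebra.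
From mathcomp Require Import all_classical all_reals all_analysis.

Set Implicit Arguments.
Unset Strict Implicit.
Unset Printing Implicit Defensive.

Import Order.TTheory GRing.Theory Num.Theory.
Import numFieldNormedType.Exports.

Local Open Scope classical_set_scope.
Local Open Scope ring_scope.

Definition measure_rV_display : measure_display -> measure_display.
Proof. exact. Qed.

(* The product sigma-algebra on row vectors, defined exactly as the library
   does for tuples; for T := R it is the Borel sigma-algebra of R^n. *)
Section measurable_rV.
Context {d : measure_display} {T : sigmaRingType d} (n : nat).

Let coord (i : 'I_n) (x : 'rV[T]_n) : T := x ord0 i.

Let rV_set0 : g_sigma_preimage coord set0.
Proof. exact: sigma_algebra0. Qed.

Let rV_setC (A : set 'rV[T]_n) :
  g_sigma_preimage coord A -> g_sigma_preimage coord (~` A).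
Proof. exact: sigma_algebraC. Qed.

Let rV_bigcup (F : (set 'rV[T]_n)^nat) :
  (forall i, g_sigma_preimage coord (F i)) ->
  g_sigma_preimage coord (\bigcup_i (F i)).
Proof. exact: sigma_algebra_bigcup. Qed.

HB.instance Definition _ := @isMeasurable.Build (measure_rV_display d)
  'rV[T]_n (g_sigma_preimage coord) rV_set0 rV_setC rV_bigcup.

End measurable_rV.

Section measurable_rV_lemmas.
Context {R : realType}.

Lemma measurable_coord_rV n (i : 'I_n) :
  measurable_fun setT (fun x : 'rV[R]_n => x ord0 i).
Proof.
move=> _ Y mY; rewrite setTI; apply: sub_sigma_algebra.
rewrite -bigcup_seq/=; exists i => /=; first by rewrite mem_index_enum.
by exists Y => //; rewrite setTI.
Qed.

Lemma measurable_fun_rV d (T : measurableType d) n (f : T -> 'rV[R]_n) :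
  (forall i, measurable_fun setT (fun x => f x ord0 i)) ->
  measurable_fun setT f.
Proof.
move=> mf; apply: (@measurability _ _ _ _ setT f _ erefl).
move=> _ [B + <-]; rewrite -bigcup_seq => -[i _ [A mA <-]].
rewrite setTI; have := mf i measurableT A mA.
by rewrite !setTI.
Qed.

Lemma open_measurable_rV n (U : set 'rV[R]_n) : open U -> measurable U.
Proof.
move=> oU.
pose box (p : 'rV[rat]_n * nat) : set 'rV[R]_n :=
  [set y | forall i, `|ratr (p.1 ord0 i) - y ord0 i| < p.2.+1%:R^-1].
have mbox p : measurable (box p).
  rewrite (_ : box p = \bigcap_(i in [set: 'I_n])
    [set y | ratr (p.1 ord0 i) - p.2.+1%:R^-1 < y ord0 i
             < ratr (p.1 ord0 i) + p.2.+1%:R^-1]); last first.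
    apply/seteqP; split => [y yp i _|y yp i]; have := yp i.
      by rewrite ltr_distlC.
    by move=> /(_ I) /=; rewrite ltr_distlC.
  apply: fin_bigcap_measurable => [|i _]; first exact: finite_finset.
  have := @measurable_coord_rV n i measurableT
    `]ratr (p.1 ord0 i) - p.2.+1%:R^-1, ratr (p.1 ord0 i) + p.2.+1%:R^-1[%classic
    (measurable_itv _).
  by rewrite setTI; congr measurable; apply/seteqP; split => y /=; rewrite in_itv.
rewrite (_ : U = \bigcup_p (if `[< box p `<=` U >] then box p else set0)).
  apply: countable_bigcupT_measurable => [|p]; first exact: countableP.
  by case: ifPn.
apply/seteqP; split => [x Ux|x [p _]]; last by case: ifPn => // /asboolP; exact.
have /nbhs_ballP[e /= e0 xeU] : nbhs x U by exact: open_nbhs_nbhs.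
have [k ke] : exists k, k.+1%:R^-1 < e / 2.
  have /ltr_add_invr[k] : 0 < e / 2 by rewrite divr_gt0.
  by rewrite add0r => ?; exists k.
have xq i : exists q : rat, `|ratr q - x ord0 i| < k.+1%:R^-1.
  have /rat_in_itvoo[q] : x ord0 i - k.+1%:R^-1 < x ord0 i + k.+1%:R^-1.
    by rewrite ltrD2l (@lt_trans _ _ 0)// ?oppr_lt0 invr_gt0.
  by rewrite in_itv/= -ltr_distl => ?; exists q.
have [q xqE] := choice xq.
have bx : box (\row_i q i, k) x by move=> i /=; rewrite mxE.
exists (\row_i q i, k) => //; case: ifPn => // /asboolPn; case=> y yb.
apply: xeU; split => // i j; rewrite ord1 /ball/=.
have := bx j; have := yb j => /= yj xj.
rewrite (le_lt_trans (ler_distD (ratr ((\row_i q i) ord0 j)) _ _))//.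
rewrite (splitr e) ltrD// ?(lt_trans _ ke)//.
by rewrite distrC.
Qed.

End measurable_rV_lemmas.

(* Lebesgue measure on R^n, as the n-fold product of the library's Lebesgue
   measure on R: the image of lebesgue_measure \x (Lebesgue on R^n) under
   (t, x) |-> row_mx t x. *)
Section lebesgue_rV.
Context {R : realType}.

Definition cons_rV n (x : R * 'rV[R]_n) : 'rV[R]_n.+1 :=
  row_mx (x.1%:M : 'rV_1) x.2.

Lemma cons_rV0 n (x : R * 'rV[R]_n) : cons_rV x ord0 ord0 = x.1.
Proof.
have -> : (ord0 : 'I_n.+1) = lshift n (ord0 : 'I_1) by exact: val_inj.
by rewrite /cons_rV (@row_mxEl _ 1 1 n) mxE.
Qed.

Lemma cons_rVS n (x : R * 'rV[R]_n) i : cons_rV x ord0 (lift ord0 i) = x.2 ord0 i.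
Proof.
have -> : lift ord0 i = rshift 1 i by exact: val_inj.
by rewrite /cons_rV (@row_mxEr _ 1 1 n).
Qed.

Let uncons n (y : 'rV[R]_n.+1) : R * 'rV[R]_n :=
  (y ord0 ord0, \row_i y ord0 (lift ord0 i)).

Let cons_rVK n : cancel (@cons_rV n) (@uncons n).
Proof.
move=> x; rewrite /uncons cons_rV0 [RHS]surjective_pairing; congr pair.
by apply/rowP => i; rewrite mxE cons_rVS.
Qed.

Lemma measurable_cons_rV n : measurable_fun setT (@cons_rV n).
Proof.
apply: measurable_fun_rV => i.
have [->|[j ->]] : i = ord0 \/ exists j, i = lift ord0 j.
  by case: (unliftP ord0 i) => [j ->|->]; [right; exists j|left].
  by under eq_fun do rewrite cons_rV0; exact: measurable_fst.
under eq_fun do rewrite cons_rVS.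
exact: (measurableT_comp (@measurable_coord_rV R n j) measurable_snd).
Qed.

Let measurable_uncons n : measurable_fun setT (@uncons n).
Proof.
apply: measurable_fun_pair; first exact: measurable_coord_rV.
apply: measurable_fun_rV => i; under eq_fun do rewrite mxE.
exact: measurable_coord_rV.
Qed.

Section cons_measure.
Variables (n : nat) (m : {sigma_finite_measure set 'rV[R]_n -> \bar R}).

Definition cons_measure : set 'rV[R]_n.+1 -> \bar R :=
  pushforward (lebesgue_measure \x m)%E (@cons_rV n).

Let cons_measure0 : cons_measure set0 = 0%E.
Proof. by rewrite /cons_measure /pushforward preimage_set0 measure0. Qed.

Let cons_measure_ge0 A : (0 <= cons_measure A)%E.
Proof. by rewrite /cons_measure /pushforward measure_ge0. Qed.

Let cons_measure_sigma_additive : semi_sigma_additive cons_measure.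
Proof.
have mX A : measurable A -> measurable (@cons_rV n @^-1` A).
  by move=> mA; rewrite -[X in measurable X]setTI; exact: measurable_cons_rV.
move=> F mF tF mUF; rewrite /cons_measure /pushforward preimage_bigcup.
apply: measure_semi_sigma_additive.
- by move=> k; exact: mX.
- apply/trivIsetP => /= i j _ _ ij; rewrite -preimage_setI.
  by move/trivIsetP : tF => /(_ _ _ _ _ ij) ->//; rewrite preimage_set0.
- by rewrite -preimage_bigcup; exact: mX.
Qed.

HB.instance Definition _ := isMeasure.Build _ _ _ cons_measure
  cons_measure0 cons_measure_ge0 cons_measure_sigma_additive.

Let cons_measure_sigma_finite : sigma_finite setT cons_measure.
Proof.
have /sigma_finiteP[F [TF ndF Foo]] := sigma_finiteT (@lebesgue_measure R).
have /sigma_finiteP[G [TG ndG Goo]] := sigma_finiteT m.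
exists (fun k => @uncons n @^-1` (F k `*` G k)).
  rewrite -preimage_bigcup -[LHS](preimage_setT (@uncons n)); congr (_ @^-1` _).
  rewrite -setXTT TF TG predeqE => -[x y]; split.
    move=> [/= [k _ Fkx] [l _ Gly]]; exists (maxn k l) => //; split.
    - by move: x Fkx; exact/subsetPset/ndF/leq_maxl.
    - by move: y Gly; exact/subsetPset/ndG/leq_maxr.
  by move=> [k _ []/= ? ?]; split; exists k.
move=> k; have [mF Fk] := Foo k; have [mG Gk] := Goo k; split.
  rewrite -[X in measurable X]setTI.
  by apply: measurable_uncons => //; exact: measurableX.
rewrite /cons_measure /pushforward -comp_preimage (_ : _ \o _ = id); last first.
  by apply/funext => x /=; rewrite cons_rVK.
by rewrite preimage_id product_measure1E// lte_mul_pinfty// ge0_fin_numE.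
Qed.

HB.instance Definition _ := Measure_isSigmaFinite.Build _ _ _ cons_measure
  cons_measure_sigma_finite.

End cons_measure.

Fixpoint lebesgue_measure_rV n : {sigma_finite_measure set 'rV[R]_n -> \bar R} :=
  match n with
  | 0 => \d_(0 : 'rV[R]_0)
  | n.+1 => cons_measure (lebesgue_measure_rV n)
  end.

Lemma lebesgue_measure_rV_box n (a b : 'rV[R]_n) :
  (forall i, a ord0 i <= b ord0 i) ->
  lebesgue_measure_rV n
    [set x | forall i, a ord0 i <= x ord0 i <= b ord0 i] =
  (\prod_(i < n) (b ord0 i - a ord0 i))%:E.
Proof.
elim: n => [|n IH] in a b * => ab.
  by rewrite big_ord0/= diracE mem_set// => -[].
rewrite big_ord_recl /= /cons_measure /pushforward.
pose tl (y : 'rV[R]_n.+1) : 'rV[R]_n := \row_i y ord0 (lift ord0 i).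
pose B := [set x : 'rV[R]_n | forall i, tl a ord0 i <= x ord0 i <= tl b ord0 i].
have -> : @cons_rV n @^-1` [set x | forall i, a ord0 i <= x ord0 i <= b ord0 i] =
    `[a ord0 ord0, b ord0 ord0]%classic `*` B.
  apply/seteqP; split => [x /= abx|x /= [x1 x2] i].
    split; first by have := abx ord0; rewrite cons_rV0 in_itv.
    by move=> i; have := abx (lift ord0 i); rewrite cons_rVS !mxE.
  case: (unliftP ord0 i) => [j ->|->]; last by rewrite cons_rV0.
  by rewrite cons_rVS; have := x2 j; rewrite !mxE.
have mB : measurable B.
  rewrite (_ : B = \bigcap_(i in [set: 'I_n])
    ((fun x => x ord0 i) @^-1` `[tl a ord0 i, tl b ord0 i]%classic)).
    apply: fin_bigcap_measurable => [|i _]; first exact: finite_finset.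
    rewrite -[X in measurable X]setTI.
    exact: (@measurable_coord_rV R n i measurableT _ (measurable_itv _)).
  apply/seteqP; split => [x xB i _|x xB i] /=; first by rewrite in_itv/= xB.
  by have := xB i I; rewrite /= in_itv.
rewrite product_measure1E//= lebesgue_measure_itv/= lte_fin.
rewrite /B IH; last by move=> i; rewrite !mxE.
rewrite [in RHS]EFinM; congr (_ * _)%E.
  case: ltP => // ba; apply/eqP.
  by rewrite eq_sym eqe subr_eq0 eq_le ba ab.
by congr EFin; apply: eq_bigr => i _; rewrite !mxE.
Qed.

End lebesgue_rV.

Section geometry.
Context {R : realType} {d : nat}.

Record bounded_domain := BoundedDomain {
  dom :> set 'rV[R]_d;
  dom_nonempty : dom !=set0;
  dom_open : open dom;
  dom_connected : connected dom;
  dom_bounded : bounded_set dom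
}.

Definition affinely_independent (v : 'I_d.+1 -> 'rV[R]_d) : Prop :=
  forall l : 'I_d.+1 -> R,
    \sum_i l i = 0 -> \sum_i l i *: v i = 0 -> forall i, l i = 0.

Definition simplex (v : 'I_d.+1 -> 'rV[R]_d) : set 'rV[R]_d :=
  [set x | exists l : 'I_d.+1 -> R,
    [/\ forall i, 0 <= l i, \sum_i l i = 1 & x = \sum_i l i *: v i]].

(* Triangles for d = 2 and tetrahedra for d = 3.  Elements are closed, so they
   share boundary points; hanging nodes are not excluded. *)
Record triangulation (D : bounded_domain) := Triangulation {
  nb_elt : nat;
  elt : 'I_nb_elt -> set 'rV[R]_d;
  elt_simplex : forall i, exists2 v, affinely_independent v & elt i = simplex v;
  elt_disjoint : forall i j, i != j -> (elt i)° `&` (elt j)° = set0;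
  elt_cover : \bigcup_i elt i = closure D
}.

End geometry.
Arguments bounded_domain : clear implicits.
Arguments dom_open {R d} b.
Arguments elt {R d D} t i.

Section L2.
Context {R : realType} {d : nat} (D : bounded_domain R d).

Definition lebesgue_dom : {measure set 'rV[R]_d -> \bar R} :=
  mrestr (lebesgue_measure_rV d) (open_measurable_rV (dom_open D)).

(* Square-integrable functions for Lebesgue measure restricted to D.  Elements
   of L^2(D) are represented by functions, so identities in L^2(D) are stated
   as equalities almost everywhere in D. *)
Definition L2 := LfunType lebesgue_dom (lee1n 2).

Definition L2_inner (f g : L2) : R := \int[lebesgue_dom]_x (f x * g x).

Definition L2_eq (f g : L2) : Prop := {ae lebesgue_dom, forall x, f x = g x}.

(* Theta: the functions that are (a.e.) constant on each element. *)
Definition Theta (T : triangulation D) : set L2 :=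
  [set f | forall i, exists c : R,
    {ae lebesgue_dom, forall x, elt T i x -> f x = c}].

Definition is_L2_projection (T : triangulation D) (Q : L2 -> L2) : Prop :=
  forall f, Theta T (Q f) /\
    forall g, Theta T g -> L2_inner (f - Q f) g = 0.

Definition is_elt_basis (T : triangulation D) (chi : 'I_(nb_elt T) -> L2) :
    Prop :=
  forall i, exists2 c : R, c != 0 &
    {ae lebesgue_dom, forall x, chi i x = c * \1_(elt T i) x}.

Definition mass_mx n (chi : 'I_n -> L2) : 'M[R]_n :=
  \matrix_(i, j) L2_inner (chi i) (chi j).

(* Coordinates in the family chi; meaningful only for f in the span of a
   linearly independent family, an arbitrary vector otherwise. *)
Definition coef n (chi : 'I_n -> L2) (f : L2) : 'rV[R]_n :=
  get [set c : 'rV[R]_n | L2_eq f (\sum_i c ord0 i *: chi i)].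

End L2.

Section gaussian.
Context {d : measure_display} {Omega : measurableType d} {R : realType}.
Variable P : probability Omega R.

(* normal_prob takes the standard deviation, and its value at standard
   deviation 0 is not the Dirac mass. *)
Definition normal_law (m v : R) : set R -> \bar R :=
  if v == 0 then \d_m else normal_prob m (Num.sqrt v).

(* X ~ N(m, S): every linear combination of the components is normal. *)
Definition gaussian_vector n (X : Omega -> 'rV[R]_n) (m : 'rV[R]_n)
    (S : 'M[R]_n) : Prop :=
  measurable_fun setT X /\
  forall (a : 'cV[R]_n) (B : set R), measurable B ->
    P ((fun w => (X w *m a) ord0 ord0) @^-1` B) =
    normal_law ((m *m a) ord0 ord0) ((a^T *m S *m a) ord0 ord0) B.

Definition independent_vectors m n (X : Omega -> 'rV[R]_m)
    (Y : Omega -> 'rV[R]_n) : Prop :=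
  forall A B, measurable A -> measurable B ->
    P (X @^-1` A `&` Y @^-1` B) = (P (X @^-1` A) * P (Y @^-1` B))%E.

Definition white_noise_repr k (D : bounded_domain R k) (T : triangulation D)
    (chi : 'I_(nb_elt T) -> L2 D) (zeta : Omega -> L2 D) : Prop :=
  (forall w, Theta T (zeta w)) /\
  gaussian_vector (fun w => \row_i L2_inner (zeta w) (chi i)) 0 (mass_mx chi).

End gaussian.

(* Main.v *)
Require Import Defs.
From mathcomp Require Import all_boot all_order all_algebra.
From mathcomp Require Import all_classical all_reals all_analysis measurable_realfun.
From mathcomp Require Import ring lra.

Set Implicit Arguments.
Unset Strict Implicit.
Unset Printing Implicit Defensive.

Import Order.TTheory GRing.Theory Num.Theory.
Import numFieldNormedType.Exports.

Local Open Scope classical_set_scope.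
Local Open Scope ring_scope.

(** For f in Theta_h write m(f) for the vector of its L^2 inner products with
the basis chi_h (the moments of f) and c(f) for its coefficients; then
m(f) = c(f) W_h.  With the cross Gram matrix G = ((chi_H,i , chi_h,j)), the
projection acts on moments by f |-> m_H(f) W_H^-1 G, and m_H(f) = c(f) G^T, so
pointwise on the probability space
<<
   m(zeta') = c_H(zeta_H) G + c_h(zeta_h) (W_h - K),   K = G^T W_H^-1 G.
>>
The two terms are independent centred Gaussian vectors, so the sum is a centred
Gaussian vector with covariance K + (W_h - K) W_h^-1 (W_h - K).  Nestedness
of the spaces says G W_h^-1 G^T = W_H ([mass_mx_nested]): expand a coarse basis
function in the fine basis and integrate.  Hence K W_h^-1 K = K and the
covariance is K + W_h - 2 K + K = W_h ([covariance_identity]).  Multiplying by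
W_h^-1 gives the law of the coefficients.

Two facts are behind this computation.

- The sum of two independent centred normal variables is normal
([normal_law_add_independent]).  The joint law is the product of the laws, and
the product of densities p_s(x) p_t(z - x) is, after completing the square,
p_r(z) with r^2 = s^2 + t^2 times a normal density in x, which integrates to 1
([normal_pdf_convolution]).

- The elements of a triangulation overlap in Lebesgue-null sets and each
meets D in positive measure ([ae_unique_elt], [lebesgue_dom_elt_gt0]).  The
first makes the indicators span Theta ([Theta_span]) and the second makes the mass
matrix invertible ([mass_mx_unit]), so that coefficients are well defined.  A
point of a simplex outside its interior has a zero barycentric coordinate, hence
lies on one of finitely many hyperplanes, and a hyperplane is null by Fubini
and induction on the dimension ([lebesgue_measure_rV_hyperplane]). *)

(** * Convolution of centred normal laws *)

Section normal_convolution.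
Context {R : realType}.
Local Notation leb := (@lebesgue_measure R).
Local Open Scope ereal_scope.

(** The normal law has density [normal_pdf]: its Radon-Nikodym derivative, which
the change of variables formula uses, has the same integrals as [normal_pdf]
over every measurable set. *)
Lemma integral_normal_prob (m s : R) (f : R -> \bar R) :
  measurable_fun [set: R] f -> (forall x, 0 <= f x) ->
  \int[normal_prob m s]_x f x = \int[leb]_x (f x * (normal_pdf m s x)%:E).
Proof.
move=> mf f0.
have dom := normal_prob_dominates m s.
rewrite -(Radon_Nikodym_SigmaFinite.change_of_variables dom)//.
have mpdf : measurable_fun [set: R] (fun x => (normal_pdf m s x)%:E).
  by apply/measurable_EFinP; exact: measurable_normal_pdf.
have mrn := measurable_int _ (Radon_Nikodym_SigmaFinite.f_integrable dom).
apply: ae_eq_integral => //.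
- exact: emeasurable_funM.
- exact: emeasurable_funM.
- have : ae_eq leb setT (Radon_Nikodym_SigmaFinite.f (normal_prob m s) leb)
     (fun x => (normal_pdf m s x)%:E).
    apply: integral_ae_eq => //.
      exact: Radon_Nikodym_SigmaFinite.f_integrable.
    by move=> A _ mA; rewrite -Radon_Nikodym_SigmaFinite.f_integral.
  by apply: filterS => x /[apply] <-.
Qed.

Lemma lebesgue_measureD (a : R) (A : set R) : measurable A ->
  pushforward leb ((fun x => a + x)%R : R -> measurableTypeR R) A = leb A.
Proof.
have ma : @measurable_fun _ _ (measurableTypeR R) (measurableTypeR R) setT
    (fun x => a + x)%R.
  exact: measurable_funD.
pose shift : {mfun measurableTypeR R >-> measurableTypeR R} :=
  @mfun_Sub _ _ (measurableTypeR R) (measurableTypeR R) _ (mem_set ma).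
move=> mA.
apply/esym/(lebesgue_measure_unique (mu := pushforward leb shift)) => //.
move=> _ [[b c] _ <-]; rewrite /pushforward/=.
rewrite [X in _ = leb X](_ : _ = `](b - a)%R, (c - a)%R]%classic); last first.
  by apply/seteqP; split => x /=; rewrite !in_itv/= lerBrDl ltrBlDl.
by rewrite !lebesgue_measure_itv/= !lte_fin ltrD2r -!EFinD opprD addrACA subrr addr0.
Qed.

Lemma normal_prob_shift (x s : R) (B : set R) : s != 0%R -> measurable B ->
  normal_prob 0 s ((fun y => x + y)%R @^-1` B) = normal_prob x s B.
Proof.
move=> s0 mB.
have mx : @measurable_fun _ _ (measurableTypeR R) (measurableTypeR R) setT
    (fun y => x + y)%R.
  exact: measurable_funD.
pose shift : {mfun measurableTypeR R >-> measurableTypeR R} :=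
  @mfun_Sub _ _ (measurableTypeR R) (measurableTypeR R) _ (mem_set mx).
rewrite /normal_prob.
under eq_integral.
  move=> y _; rewrite (_ : normal_pdf 0 s y = normal_pdf x s (shift y)); last first.
    by rewrite !normal_pdfE//= /normal_fun /= subr0 addrC addKr.
  over.
rewrite -[LHS](@ge0_integral_pushforward _ _ _ _ _ shift mx leb B
    (fun z => (normal_pdf x s z)%:E))//.
- by apply: eq_measure_integral => A mA _; exact: lebesgue_measureD.
- by apply/measurable_EFinP; apply: measurable_funTS; exact: measurable_normal_pdf.
- by move=> y _; rewrite lee_fin normal_pdf_ge0.
Qed.

(** Completing the square in x, where z is the value of the sum: the right-hand
side is the density of the sum at z times the conditional density of the first
summand given the sum. *)
Lemma normal_pdf_convolution (s t x z : R) : s != 0%R -> t != 0%R ->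
  (normal_pdf 0 s x * normal_pdf x t z =
   normal_pdf 0 (Num.sqrt (s ^+ 2 + t ^+ 2)) z *
   normal_pdf (s ^+ 2 / (s ^+ 2 + t ^+ 2) * z)
     (s * t / Num.sqrt (s ^+ 2 + t ^+ 2)) x)%R.
Proof.
move=> s0 t0.
have s2 : (0 < s ^+ 2)%R by rewrite exprn_even_gt0.
have t2 : (0 < t ^+ 2)%R by rewrite exprn_even_gt0.
have r2 : (0 < s ^+ 2 + t ^+ 2)%R by rewrite addr_gt0.
have r0 : (Num.sqrt (s ^+ 2 + t ^+ 2) != 0)%R by rewrite gt_eqF// sqrtr_gt0.
rewrite !normal_pdfE// ?mulf_neq0 ?invr_neq0// mulrACA [RHS]mulrACA.
congr (_ * _)%R.
  have peak_ge0 (u : R) : (0 <= u ^+ 2 * pi *+ 2)%R.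
    by rewrite mulrn_wge0// mulr_ge0 ?pi_ge0// sqr_ge0.
  rewrite /normal_peak -!invfM -!sqrtrM//.
  congr ((Num.sqrt _)^-1)%R.
  rewrite expr_div_n exprMn sqr_sqrtr; last exact: ltW.
  by field; rewrite gt_eqF.
rewrite /normal_fun. rewrite -!expRD; congr expR.
rewrite expr_div_n exprMn sqr_sqrtr; last exact: ltW.
by field; rewrite gt_eqF// s0 t0.
Qed.

Let measurable_normal_pdf2 (t : R) : t != 0%R ->
  measurable_fun [set: R * R] (fun p => normal_pdf p.1 t p.2).
Proof.
move=> t0; under eq_fun do rewrite normal_pdfE//.
apply: measurable_funM => //; apply: measurableT_comp => //=.
apply: measurable_funM => //; apply: measurableT_comp => //=.
apply: measurable_funX; apply: measurable_funB => //.
Qed.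

(** The left-hand side is the law of X + Y for independent X of variance s^2 and
Y of variance t^2: given X = x, the sum is normal with mean x. After Tonelli
exchanges the integrals, the conditional density of X integrates to 1. *)
Lemma normal_prob_convolution (s t : R) (B : set R) :
  s != 0%R -> t != 0%R -> measurable B ->
  \int[normal_prob 0 s]_x normal_prob x t B =
  normal_prob 0 (Num.sqrt (s ^+ 2 + t ^+ 2)) B.
Proof.
move=> s0 t0 mB.
pose g (p : R * R) : \bar R := (normal_pdf p.1 t p.2)%:E * (\1_B p.2)%:E.
have g0 p : 0 <= g p by rewrite mule_ge0// lee_fin normal_pdf_ge0.
have mg : measurable_fun [set: R * R] g.
  apply: emeasurable_funM; apply/measurable_EFinP.
    exact: measurable_normal_pdf2.
  exact: (measurableT_comp (measurable_indic mB)).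
pose f (p : R * R) : \bar R := (normal_pdf 0 s p.1)%:E * g p.
have f0 p : 0 <= f p by rewrite mule_ge0// lee_fin normal_pdf_ge0.
have mf : measurable_fun [set: R * R] f.
  apply: emeasurable_funM => //; apply/measurable_EFinP.
  exact: (measurableT_comp (measurable_normal_pdf 0 s)).
have normalE m u : normal_prob m u B =
    \int[leb]_z ((normal_pdf m u z)%:E * (\1_B z)%:E).
  rewrite /normal_prob integral_mkcond; apply: eq_integral => z _.
  by rewrite patchE indicE; case: ifPn; rewrite ?mule1 ?mule0.
under eq_integral do rewrite normalE.
rewrite integral_normal_prob//; last 2 first.
- exact: (measurable_fun_fubini_tonelli_F (m2 := leb) g mg g0).
- by move=> x; apply: integral_ge0 => z _; exact: (g0 (x, z)).
rewrite normalE.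
transitivity (\int[leb]_x \int[leb]_z f (x, z)).
  apply: eq_integral => x _; rewrite muleC -ge0_integralZl//.
  - apply: emeasurable_funM; apply/measurable_EFinP.
      exact: measurable_normal_pdf.
    exact: measurable_indic.
  - by move=> z _; exact: (g0 (x, z)).
  - by rewrite lee_fin normal_pdf_ge0.
rewrite (fubini_tonelli (m1 := leb) (m2 := leb) f mf f0); apply: eq_integral => z _.
rewrite /f /g/=.
under eq_integral do
  rewrite -!EFinM mulrA normal_pdf_convolution// mulrAC EFinM.
rewrite ge0_integralZl//; last 3 first.
- by apply/measurable_EFinP; exact: measurable_normal_pdf.
- by move=> x _; rewrite lee_fin normal_pdf_ge0.
- by rewrite lee_fin mulr_ge0// normal_pdf_ge0.
by rewrite integral_normal_pdf mule1 EFinM.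
Qed.

End normal_convolution.

(** * Sums of independent normal variables *)

Section independent_sum.
Context d (Omega : measurableType d) (R : realType) (P : probability Omega R).
Local Open Scope ereal_scope.

Lemma joint_law_independent d1 d2 (T1 : measurableType d1)
    (T2 : measurableType d2) (X : Omega -> T1) (Y : Omega -> T2)
    (mX : measurable_fun setT X) (mY : measurable_fun setT Y)
    (m1 : probability T1 R) (m2 : probability T2 R) :
  (forall B, measurable B -> P (X @^-1` B) = m1 B) ->
  (forall B, measurable B -> P (Y @^-1` B) = m2 B) ->
  (forall A B, measurable A -> measurable B ->
    P (X @^-1` A `&` Y @^-1` B) = P (X @^-1` A) * P (Y @^-1` B)) ->
  forall S, measurable S ->
    P ((fun w => (X w, Y w)) @^-1` S) = (m1 \x m2) S.
Proof.
move=> lX lY XY S mS.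
have mXY : measurable_fun setT (fun w => (X w, Y w)).
  exact: measurable_fun_pair.
pose Z := mfun_Sub (mem_set mXY).
rewrite (product_measure_unique (m' := pushforward P Z))//.
by move=> A B mA mB; rewrite [LHS]XY// lX// lY.
Qed.

Let measurable_add_preimage (B : set R) : measurable B ->
  measurable [set z : measurableTypeR R * measurableTypeR R | B (z.1 + z.2)%R].
Proof.
move=> mB; have : measurable_fun setT (fun z : R * R => z.1 + z.2)%R.
  by apply: measurable_funD; [exact: measurable_fst|exact: measurable_snd].
by move=> /(_ measurableT _ mB); rewrite setTI.
Qed.

(** The laws are measures on [measurableTypeR R], the copy of R that carries the
Lebesgue measure and therefore [normal_prob]. *)
Lemma law_add_independent (X Y : Omega -> R) (mX : measurable_fun setT X)
    (mY : measurable_fun setT Y) (m1 m2 : probability (measurableTypeR R) R) :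
  (forall B, measurable B -> P (X @^-1` B) = m1 B) ->
  (forall B, measurable B -> P (Y @^-1` B) = m2 B) ->
  (forall A B, measurable A -> measurable B ->
    P (X @^-1` A `&` Y @^-1` B) = P (X @^-1` A) * P (Y @^-1` B)) ->
  forall B, measurable B ->
    P ((fun w => (X w + Y w)%R) @^-1` B) =
    \int[m1]_x m2 ((fun y => (x + y)%R) @^-1` B).
Proof.
move=> lX lY XY B mB.
have mS := measurable_add_preimage mB.
rewrite [LHS](joint_law_independent (T1 := measurableTypeR R)
  (T2 := measurableTypeR R) mX mY lX lY XY mS).
rewrite /product_measure1; apply: eq_integral => x _ /=.
by congr (m2 _); apply/seteqP; split => y; rewrite /xsection/= inE.
Qed.

(** Variance 0 needs its own argument because [normal_law] is then a Dirac mass,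
which has no density. *)
Let normal_law_add_dirac (X Y : Omega -> R) (mX : measurable_fun setT X)
    (mY : measurable_fun setT Y) (v : R) :
  (forall B, measurable B -> P (X @^-1` B) = normal_law 0 0 B) ->
  (forall B, measurable B -> P (Y @^-1` B) = normal_law 0 v B) ->
  (forall A B, measurable A -> measurable B ->
    P (X @^-1` A `&` Y @^-1` B) = P (X @^-1` A) * P (Y @^-1` B)) ->
  forall B, measurable B ->
    P ((fun w => (X w + Y w)%R) @^-1` B) = normal_law 0 v B.
Proof.
rewrite /normal_law eqxx => lX lY XY B mB.
have mS := measurable_add_preimage mB.
have [m2 m2E] : exists m : probability (measurableTypeR R) R, normal_law 0 v = m.
  rewrite /normal_law; case: ifP => _.
    by exists [the probability _ _ of \d_(0%R : measurableTypeR R)].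
  by exists [the probability _ _ of normal_prob 0 (Num.sqrt v)].
rewrite (law_add_independent (m1 := \d_(0%R : measurableTypeR R))
  (m2 := m2) mX mY lX _ XY)//; last first.
  by move=> C mC; rewrite lY// -m2E.
rewrite integral_dirac//; last first.
  have := measurable_fun_xsection m2 mS; congr measurable_fun.
  apply/funext => x /=.
  by congr (m2 _); apply/seteqP; split => y; rewrite /xsection/= inE.
rewrite diracT mul1e -/(normal_law 0 v) m2E; congr (m2 _).
by apply/seteqP; split => y /=; rewrite add0r.
Qed.

Lemma normal_law_add_independent (X Y : Omega -> R)
    (mX : measurable_fun setT X) (mY : measurable_fun setT Y) (v w : R) :
  (0 <= v)%R -> (0 <= w)%R ->
  (forall B, measurable B -> P (X @^-1` B) = normal_law 0 v B) ->
  (forall B, measurable B -> P (Y @^-1` B) = normal_law 0 w B) ->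
  (forall A B, measurable A -> measurable B ->
    P (X @^-1` A `&` Y @^-1` B) = P (X @^-1` A) * P (Y @^-1` B)) ->
  forall B, measurable B ->
    P ((fun t => (X t + Y t)%R) @^-1` B) = normal_law 0 (v + w) B.
Proof.
move=> v0 w0 lX lY XY B mB.
have [vz|vN0] := eqVneq v 0%R.
  rewrite vz in lX; rewrite vz add0r.
  exact: (normal_law_add_dirac mX mY lX lY XY mB).
have [wz|wN0] := eqVneq w 0%R.
  rewrite wz addr0 (_ : (fun t => _) = (fun t => Y t + X t)%R); last first.
    by apply/funext => t; rewrite addrC.
  rewrite wz in lY.
  apply: (normal_law_add_dirac mY mX lY lX _ mB) => A C mA mC.
  by rewrite setIC XY// muleC.
have vgt0 : (0 < v)%R by rewrite lt_neqAle eq_sym vN0.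
have wgt0 : (0 < w)%R by rewrite lt_neqAle eq_sym wN0.
rewrite /normal_law (gt_eqF (addr_gt0 vgt0 wgt0)).
rewrite (law_add_independent mX mY (m1 := normal_prob 0 (Num.sqrt v))
  (m2 := normal_prob 0 (Num.sqrt w)) _ _ XY)//.
- have sv0 : Num.sqrt v != 0%R by rewrite gt_eqF// sqrtr_gt0.
  have sw0 : Num.sqrt w != 0%R by rewrite gt_eqF// sqrtr_gt0.
  transitivity (\int[normal_prob 0 (Num.sqrt v)]_x normal_prob x (Num.sqrt w) B).
    by apply: eq_integral => x _; exact: normal_prob_shift.
  rewrite [LHS](normal_prob_convolution sv0 sw0 mB).
  by rewrite (sqr_sqrtr v0) (sqr_sqrtr w0).
- by move=> C mC; rewrite lX// /normal_law (negbTE vN0).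
- by move=> C mC; rewrite lY// /normal_law (negbTE wN0).
Qed.

End independent_sum.

(** * Linear images and independent sums of Gaussian vectors *)

Section gaussian_vectors.
Context d (Omega : measurableType d) (R : realType) (P : probability Omega R).

Lemma measurable_mulmx_rV n p (A : 'M[R]_(n, p)) :
  measurable_fun setT (fun x : 'rV[R]_n => x *m A).
Proof.
apply: measurable_fun_rV => j; under eq_fun do rewrite mxE.
apply: measurable_sum => i; apply: measurable_funM => //.
exact: measurable_coord_rV.
Qed.

Lemma gaussian_vector_mulmx n p (X : Omega -> 'rV[R]_n) (S : 'M[R]_n)
    (A : 'M[R]_(n, p)) : gaussian_vector P X 0 S ->
  gaussian_vector P (fun w => X w *m A) 0 (A^T *m S *m A).
Proof.
move=> [mX lX]; split=> [|a B mB].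
  exact: (measurableT_comp (measurable_mulmx_rV A)).
rewrite (_ : (fun w => _) = (fun w => (X w *m (A *m a)) ord0 ord0)); last first.
  by apply/funext => w; rewrite mulmxA.
rewrite (lX _ _ mB).
by rewrite (mul0mx _ (A *m a)) mul0mx trmx_mul !mulmxA.
Qed.

(** The covariances are assumed positive semidefinite so that every linear
combination of the components has a nonnegative variance; for a negative v,
[normal_law 0 v] is not a normal law. *)
Lemma gaussian_vectorD_independent m n p (X : Omega -> 'rV[R]_m)
    (Y : Omega -> 'rV[R]_n) (S : 'M[R]_m) (T : 'M[R]_n)
    (A : 'M[R]_(m, p)) (B : 'M[R]_(n, p)) :
  (forall a : 'cV_m, 0 <= (a^T *m S *m a) ord0 ord0) ->
  (forall a : 'cV_n, 0 <= (a^T *m T *m a) ord0 ord0) ->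
  gaussian_vector P X 0 S -> gaussian_vector P Y 0 T ->
  independent_vectors P X Y ->
  gaussian_vector P (fun w => X w *m A + Y w *m B) 0
    (A^T *m S *m A + B^T *m T *m B).
Proof.
move=> S0 T0 [mX lX] [mY lY] XY; split=> [|a C mC].
  apply: measurable_fun_rV => j; under eq_fun do rewrite mxE.
  apply: measurable_funD; apply: (measurableT_comp (measurable_coord_rV j)).
    exact: (measurableT_comp (measurable_mulmx_rV A)).
  exact: (measurableT_comp (measurable_mulmx_rV B)).
have mlin k (b : 'cV[R]_k) : measurable_fun setT (fun x : 'rV[R]_k => (x *m b) ord0 ord0).
  exact: (measurableT_comp (measurable_coord_rV _) (measurable_mulmx_rV b)).
have {}mlin k (b : 'cV[R]_k) (E : set R) : measurable E ->
    measurable ((fun x : 'rV[R]_k => (x *m b) ord0 ord0) @^-1` E).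
  by move=> mE; rewrite -[X in measurable X]setTI; exact: mlin.
have mlX (b : 'cV[R]_m) : measurable_fun setT (fun w => (X w *m b) ord0 ord0).
  exact: (measurableT_comp (measurable_coord_rV ord0)
    (measurableT_comp (measurable_mulmx_rV b) mX)).
have mlY (b : 'cV[R]_n) : measurable_fun setT (fun w => (Y w *m b) ord0 ord0).
  exact: (measurableT_comp (measurable_coord_rV ord0)
    (measurableT_comp (measurable_mulmx_rV b) mY)).
have varE : (a^T *m (A^T *m S *m A + B^T *m T *m B) *m a) ord0 ord0 =
    ((A *m a)^T *m S *m (A *m a)) ord0 ord0 +
    ((B *m a)^T *m T *m (B *m a)) ord0 ord0.
  by rewrite mulmxDr mulmxDl mxE !trmx_mul !mulmxA.
have linE : (fun w => ((X w *m A + Y w *m B) *m a) ord0 ord0) =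
    (fun w => (X w *m (A *m a)) ord0 ord0 + (Y w *m (B *m a)) ord0 ord0).
  by apply/funext => w; rewrite mulmxDl mxE !mulmxA.
have mean0 k (b : 'cV[R]_k) : ((0 : 'rV_k) *m b) ord0 ord0 = 0.
  by rewrite mul0mx mxE.
rewrite varE linE mean0.
apply: (normal_law_add_independent (mlX _) (mlY _) (S0 _) (T0 _) _ _ _ mC).
- by move=> E mE; rewrite (lX _ _ mE) mean0.
- by move=> E mE; rewrite (lY _ _ mE) mean0.
- move=> E F mE mF.
  exact: (XY _ _ (mlin _ _ _ mE) (mlin _ _ _ mF)).
Qed.

End gaussian_vectors.

(** * Lebesgue measure of open sets and hyperplanes *)

Section lebesgue_measure_rV_theory.
Context {R : realType}.

Lemma measurable_forall_rV n (J : finType) (f : J -> 'rV[R]_n -> R)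
    (B : J -> set R) :
  (forall i, measurable_fun setT (f i)) -> (forall i, measurable (B i)) ->
  measurable [set x | forall i, B i (f i x)].
Proof.
move=> mf mB; rewrite (_ : mkset _ = \bigcap_(i in [set: J]) (f i @^-1` B i)).
  apply: fin_bigcap_measurable => [|i _]; first exact: finite_finset.
  by rewrite -[X in measurable X]setTI; exact: mf.
by apply/seteqP; split => [x xB i _|x xB i]; [exact: xB|exact: (xB i I)].
Qed.

Lemma lebesgue_measure_rV_open_gt0 n (U : set 'rV[R]_n) :
  open U -> U !=set0 -> (0 < lebesgue_measure_rV n U)%E.
Proof.
move=> oU [x Ux].
have /nbhs_ballP[e /= e0 xeU] : nbhs x U by exact: open_nbhs_nbhs.
pose a : 'rV[R]_n := \row_i (x ord0 i - e / 2).
pose b : 'rV[R]_n := \row_i (x ord0 i + e / 2).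
pose box := [set y : 'rV[R]_n | forall i, a ord0 i <= y ord0 i <= b ord0 i].
have boxU : box `<=` U.
  move=> y yb; apply: xeU; split => // i j; rewrite ord1 /ball/=.
  have := yb j; rewrite !mxE -ler_distl distrC => /le_lt_trans; apply.
  by rewrite gtr_pMr// invf_lt1// ltr1n.
have mbox : measurable box.
  rewrite (_ : box = [set y | forall i,
      `[a ord0 i, b ord0 i]%classic (y ord0 i)]); last first.
    by apply/seteqP; split => y yb i /=; have := yb i; rewrite /= in_itv.
  apply: (measurable_forall_rV (f := fun i y => y ord0 i)
    (B := fun i => `[a ord0 i, b ord0 i]%classic)) => i //.
  exact: measurable_coord_rV.
apply: (@lt_le_trans _ _ (lebesgue_measure_rV n box)); last first.
  apply: le_measure => //; rewrite ?inE//; exact: open_measurable_rV.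
rewrite lebesgue_measure_rV_box; last first.
  by move=> i; rewrite !mxE lerD2l ge0_cp// divr_ge0// ltW.
rewrite lte_fin prodr_gt0// => i _; rewrite !mxE.
by have -> : x ord0 i + e / 2 - (x ord0 i - e / 2) = e by lra.
Qed.

Lemma measurable_hyperplane n (a : 'I_n -> R) (b : R) :
  measurable [set x : 'rV[R]_n | \sum_i x ord0 i * a i = b].
Proof.
have : measurable_fun setT (fun x : 'rV[R]_n => \sum_i x ord0 i * a i).
  apply: measurable_sum => i; apply: measurable_funM => //.
  exact: measurable_coord_rV.
by move=> /(_ measurableT [set b] (measurable_set1 _)); rewrite setTI.
Qed.

(** Induction on the dimension, splitting off the first coordinate t. If some
other coefficient is nonzero, each section at fixed t is a hyperplane of lower
dimension, hence null. Otherwise the equation fixes t, and the hyperplane is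
a product with a singleton factor. *)
Lemma lebesgue_measure_rV_hyperplane n (a : 'I_n -> R) (b : R) :
  (exists i, a i != 0) ->
  lebesgue_measure_rV n [set x | \sum_i x ord0 i * a i = b] = 0%E.
Proof.
elim: n => [|n IH] in a b *; first by case=> -[].
move=> [i ai0].
rewrite /= /cons_measure /pushforward/=.
set H := (X in (_ \x _)%E X).
have HE : H = [set x : R * 'rV[R]_n | \sum_i x.2 ord0 i * a (lift ord0 i) = b - x.1 * a ord0].
  have sumE (x : R * 'rV[R]_n) : \sum_i cons_rV x ord0 i * a i =
      x.1 * a ord0 + \sum_i x.2 ord0 i * a (lift ord0 i).
    rewrite big_ord_recl cons_rV0; congr (_ + _).
    by apply: eq_bigr => j _; rewrite cons_rVS.
  apply/seteqP; split => x; rewrite /H/= sumE.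
  - by move=> <-; rewrite addrAC subrr add0r.
  - by move=> ->; rewrite addrC subrK.
have [[j aj0]|/forallNP atl] := pselect (exists j, a (lift ord0 j) != 0).
  rewrite /product_measure1 integral0_eq// => t _ /=.
  rewrite -[RHS](IH (fun j => a (lift ord0 j)) (b - t * a ord0)); last by exists j.
  congr (lebesgue_measure_rV n _).
  by rewrite HE; apply/seteqP; split => x; rewrite /xsection/= inE.
have a00 : a ord0 != 0.
  case: (unliftP ord0 i) ai0 => [j ->|-> //] aj0.
  by case: (atl j).
have -> : H = [set b / a ord0] `*` setT.
  rewrite HE; apply/seteqP; split => -[t x]/=; rewrite big1.
  - move=> /esym/eqP; rewrite subr_eq0 => /eqP ->; split => //.
    by rewrite mulfK.
  - by move=> j _; have /negP/negPn/eqP -> := atl j; rewrite mulr0.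
  - by move=> [-> _]; rewrite divfK// subrr.
  - by move=> j _; have /negP/negPn/eqP -> := atl j; rewrite mulr0.
by rewrite product_measure1E// [X in (X * _)%E]lebesgue_measure_set1 mul0e.
Qed.

End lebesgue_measure_rV_theory.

(** * Barycentric coordinates and the interior of a simplex *)

Section simplices.
Context {R : realType} {d : nat}.
Implicit Types (v : 'I_d.+1 -> 'rV[R]_d) (x : 'rV[R]_d).

(** The vector (1, x): with the leading 1, affine combinations of points become
linear combinations, so barycentric coordinates solve a linear system. *)
Definition homog x : 'rV[R]_d.+1 := cons_rV (1, x).

Definition homog_mx v : 'M[R]_d.+1 := \matrix_i homog (v i).

Definition bary v x : 'rV[R]_d.+1 := homog x *m invmx (homog_mx v).

Let homog_sum v (l : 'rV[R]_d.+1) :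
  l *m homog_mx v = cons_rV (\sum_i l ord0 i, \sum_i l ord0 i *: v i).
Proof.
apply/rowP => j; rewrite mxE; case: (unliftP ord0 j) => [k ->|->].
  rewrite cons_rVS summxE; apply: eq_bigr => i _.
  by rewrite [homog_mx _ _ _]mxE cons_rVS mxE.
rewrite cons_rV0; apply: eq_bigr => i _.
by rewrite [homog_mx _ _ _]mxE cons_rV0 mulr1.
Qed.

Lemma homog_mx_unit v : affinely_independent v -> homog_mx v \in unitmx.
Proof.
move=> v_free; rewrite -row_free_unit; apply: inj_row_free => l.
rewrite homog_sum => l0; apply/rowP => i; rewrite [RHS]mxE.
apply: v_free.
  by have /rowP/(_ ord0) := l0; rewrite cons_rV0 mxE.
by apply/rowP => j; have /rowP/(_ (lift ord0 j)) := l0; rewrite cons_rVS !mxE.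
Qed.

Lemma simplex_bary v : affinely_independent v ->
  simplex v = [set x | forall i, 0 <= bary v x ord0 i].
Proof.
move=> /homog_mx_unit Mu; apply/seteqP; split => x.
  move=> [l [l0 l1 ->]] i; rewrite /bary /homog.
  have -> : cons_rV (1, \sum_i l i *: v i) = (\row_i l i) *m homog_mx v.
    by rewrite homog_sum; congr (cons_rV (_, _)); rewrite -?l1;
      apply: eq_bigr => k _; rewrite mxE.
  by rewrite mulmxK// mxE.
move=> x0; exists (fun i => bary v x ord0 i).
have := mulmxKV Mu (homog x); rewrite -/(bary v x) homog_sum => xE.
split => //.
  by have /rowP/(_ ord0) := xE; rewrite !cons_rV0.
by apply/rowP => j; have /rowP/(_ (lift ord0 j)) := xE; rewrite !cons_rVS.
Qed.

Lemma baryE v x i : bary v x ord0 i =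
  invmx (homog_mx v) ord0 i +
  \sum_j x ord0 j * invmx (homog_mx v) (lift ord0 j) i.
Proof.
rewrite mxE big_ord_recl cons_rV0 mul1r; congr (_ + _).
by apply: eq_bigr => j _; rewrite cons_rVS.
Qed.

Lemma continuous_bary v i : continuous (fun x => bary v x ord0 i).
Proof.
under eq_fun do rewrite baryE.
move=> x; apply: (@cvgD _ _ _ (nbhs x)); first exact: cvg_cst.
apply: (@cvg_big _ _ _ _ _ _ _ (nbhs x)) => [|j _]; first exact: add_continuous.
by apply: (@cvgM _ _ (nbhs x)); [exact: coord_continuous|exact: cvg_cst].
Qed.

Lemma interior_simplex v x : affinely_independent v ->
  (forall i, 0 < bary v x ord0 i) -> (simplex v)° x.
Proof.
move=> v_free x0; rewrite simplex_bary//.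
have near_pos : \forall y \near x, forall i, 0 < bary v y ord0 i.
  apply: (@filter_forall _ _ (fun i y => 0 < bary v y ord0 i) (nbhs x)) => i.
  exact: (cvgr_gt _ (@continuous_bary v i x)).
by apply: (@filterS _ (nbhs x) _) near_pos => y ypos i; exact: ltW.
Qed.

Lemma interior_simplex_nonempty v : affinely_independent v ->
  (simplex v)° !=set0.
Proof.
move=> v_free; have Mu := homog_mx_unit v_free.
pose l : 'rV[R]_d.+1 := const_mx d.+1%:R^-1.
exists (\sum_i l ord0 i *: v i); apply: interior_simplex => // i.
have -> : bary v (\sum_i l ord0 i *: v i) = l.
  rewrite /bary /homog.
  suff -> : cons_rV (1, \sum_i l ord0 i *: v i) = l *m homog_mx v.
    by rewrite mulmxK.
  rewrite homog_sum; congr (cons_rV (_, _)).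
  under eq_bigr do rewrite mxE.
  by rewrite sumr_const card_ord -[RHS]mulr_natr mulVf.
by rewrite mxE invr_gt0.
Qed.

(** This makes the zero set of the i-th barycentric coordinate a hyperplane. A
constant coordinate would take the same value at vertex i, where it is 1, and
at another vertex, where it is 0; the other vertex exists as 0 < d. *)
Lemma bary_nonconstant v i : (0 < d)%N -> affinely_independent v ->
  exists j, invmx (homog_mx v) (lift ord0 j) i != 0.
Proof.
move=> d0 v_free; have Mu := homog_mx_unit v_free.
have vertex k : bary v (v k) = delta_mx 0 k.
  by rewrite /bary -[homog (v k)](rowK (fun i => homog (v i))) -row_mul mulmxV// row1.
have [k ki] : exists k : 'I_d.+1, k != i.
  have [->|i0] := eqVneq i ord0; last by exists ord0; rewrite eq_sym.
  by exists ord_max; rewrite -val_eqE /= -lt0n.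
apply/not_existsP => cst.
have bary_cst x : bary v x ord0 i = invmx (homog_mx v) ord0 i.
  rewrite baryE big1 ?addr0// => j _.
  by have /negP/negPn/eqP -> := cst j; rewrite mulr0.
have := bary_cst (v k); rewrite -(bary_cst (v i)) !vertex !mxE !eqxx eq_sym.
by rewrite (negbTE ki) => /eqP; rewrite eq_sym oner_eq0.
Qed.

Lemma ae_simplex_interior v : (0 < d)%N -> affinely_independent v ->
  {ae lebesgue_measure_rV d, forall x, simplex v x -> (simplex v)° x}.
Proof.
move=> d0 v_free.
have : {ae lebesgue_measure_rV d, forall x i, bary v x ord0 i != 0}.
  apply: filter_forall => i.
  have mface := measurable_hyperplane
    (fun j => invmx (homog_mx v) (lift ord0 j) i) (- invmx (homog_mx v) ord0 i).
  exists [set x : 'rV[R]_d | \sum_j x ord0 j * invmx (homog_mx v) (lift ord0 j) i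
                  = - invmx (homog_mx v) ord0 i]; split => //.
    by apply: lebesgue_measure_rV_hyperplane; exact: bary_nonconstant.
  move=> x /= /negP/negPn; rewrite baryE addrC addr_eq0 => /eqP.
  exact.
apply: filterS => x xN0 xv; apply: interior_simplex => // i.
rewrite lt_neqAle eq_sym xN0/=.
by have := xv; rewrite simplex_bary.
Qed.

Lemma measurable_simplex v : affinely_independent v -> measurable (simplex v).
Proof.
move=> v_free; rewrite simplex_bary//.
rewrite (_ : mkset _ = [set x | forall i, `[0, +oo[%classic (bary v x ord0 i)]).
  apply: (measurable_forall_rV (f := fun i x => bary v x ord0 i)
    (B := fun=> `[0, +oo[%classic)) => i //.
  under eq_fun do rewrite baryE.
  apply: measurable_funD => //; apply: measurable_sum => j.
  by apply: measurable_funM => //; exact: measurable_coord_rV.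
by apply/seteqP; split => x x0 i; have := x0 i; rewrite /= in_itv/= andbT.
Qed.

End simplices.

(** * Triangulations up to null sets *)

Section triangulation_measure.
Context {R : realType} {d : nat} (D : bounded_domain R d).

Lemma ae_lebesgue_dom (Q : 'rV[R]_d -> Prop) :
  {ae lebesgue_measure_rV d, forall x, Q x} -> {ae lebesgue_dom D, forall x, Q x}.
Proof.
move=> [N [mN N0 QN]]; exists N; split => //.
apply/eqP; rewrite -measure_le0 -N0 /lebesgue_dom /mrestr.
have mD := open_measurable_rV (dom_open D).
by apply: le_measure; rewrite ?inE//; exact: measurableI.
Qed.

Lemma ae_in_dom : {ae lebesgue_dom D, forall x, dom D x}.
Proof.
exists (~` D); split => //.
  by apply: measurableC; exact: open_measurable_rV (dom_open D).
by rewrite /lebesgue_dom /= /mrestr setICl measure0.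
Qed.

Lemma measurable_elt (T : triangulation D) i : measurable (elt T i).
Proof. by have [v v_free ->] := elt_simplex i; exact: measurable_simplex. Qed.

(** Almost every point of an element is interior to it, and interiors of distinct
elements are disjoint. *)
Lemma ae_unique_elt (T : triangulation D) : (0 < d)%N ->
  {ae lebesgue_dom D, forall x, exists! i, elt T i x}.
Proof.
move=> d0.
have : {ae lebesgue_dom D, forall x i, elt T i x -> (elt T i)° x}.
  apply: ae_lebesgue_dom; apply: filter_forall => i.
  by have [v v_free ->] := elt_simplex i; exact: ae_simplex_interior.
move: ae_in_dom; apply: filterS2 => x Dx xint.
have [i _ xi] : (\bigcup_i elt T i) x.
  by rewrite elt_cover; exact: subset_closure.
exists i; split => // j xj; apply: contrapT => /eqP ij.
have : ((elt T i)° `&` (elt T j)°) x by split; exact: xint.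
by rewrite elt_disjoint.
Qed.

(** Elements are only contained in the closure of D, but the open interior of an
element meets D as soon as it meets the closure of D. *)
Lemma lebesgue_dom_elt_gt0 (T : triangulation D) i :
  (0 < lebesgue_dom D (elt T i))%E.
Proof.
have [x xint] : (elt T i)° !=set0.
  have [v v_free ->] := elt_simplex i; exact: interior_simplex_nonempty.
have [y [Dy yint]] : (D `&` (elt T i)°) !=set0.
  have : closure D x.
    by rewrite -(elt_cover T); exists i => //; exact: interior_subset.
  by apply; apply: open_nbhs_nbhs; split => //; exact: open_interior.
have oU : open ((elt T i)° `&` D).
  by apply: openI; [exact: open_interior|exact: dom_open].
apply: (@lt_le_trans _ _ (lebesgue_measure_rV d ((elt T i)° `&` D))).
  by apply: lebesgue_measure_rV_open_gt0 => //; exists y.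
rewrite /lebesgue_dom /= /mrestr; apply: le_measure; rewrite ?inE.
- exact: open_measurable_rV.
- apply: measurableI; first exact: measurable_elt.
  exact: open_measurable_rV (dom_open D).
- by apply: setSI; exact: interior_subset.
Qed.

End triangulation_measure.

(** * The inner product of L^2(D) *)

Section L2_theory.
Context {R : realType} {d : nat} {D : bounded_domain R d}.
Implicit Types f g h : L2 D.

Lemma L2_addE f g x : (f + g) x = f x + g x. Proof. by []. Qed.
Lemma L2_oppE f x : (- f) x = - f x. Proof. by []. Qed.
Lemma L2_scaleE (a : R) f x : (a *: f) x = a * f x. Proof. by []. Qed.
Lemma L2_sumE n (F : 'I_n -> L2 D) x : (\sum_i F i) x = \sum_i F i x.
Proof. by elim/big_rec2 : _ => [//|i y f _ <-]. Qed.

Lemma L2_combinationE n (c : 'I_n -> R) (F : 'I_n -> L2 D) x :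
  (\sum_i c i *: F i) x = \sum_i c i * F i x.
Proof. by rewrite L2_sumE; apply: eq_bigr => i _; rewrite L2_scaleE. Qed.

Lemma integrable_L2_mul f g :
  (lebesgue_dom D).-integrable setT (EFin \o (fun x => f x * g x)).
Proof.
apply/Lfun1_integrable.
exact: (Lfun2_mul_Lfun1 (LfunP f) (LfunP g)).
Qed.

Lemma L2_innerC f g : L2_inner f g = L2_inner g f.
Proof. by apply: eq_Rintegral => x _; rewrite mulrC. Qed.

Lemma L2_innerDl f g h : L2_inner (f + g) h = L2_inner f h + L2_inner g h.
Proof.
rewrite /L2_inner -RintegralD//; try exact: integrable_L2_mul.
by apply: eq_Rintegral => x _; rewrite /= mulrDl.
Qed.

Lemma L2_innerZl (a : R) f h : L2_inner (a *: f) h = a * L2_inner f h.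
Proof.
rewrite /L2_inner -RintegralZl//; last exact: integrable_L2_mul.
by apply: eq_Rintegral => x _; rewrite /= mulrA.
Qed.

Lemma L2_innerNl f h : L2_inner (- f) h = - L2_inner f h.
Proof. by rewrite -scaleN1r L2_innerZl mulN1r. Qed.

Lemma L2_inner0l h : L2_inner 0 h = 0.
Proof. by rewrite -[in LHS](scale0r (0 : L2 D)) L2_innerZl mul0r. Qed.

Lemma L2_inner_suml n (F : 'I_n -> L2 D) h :
  L2_inner (\sum_i F i) h = \sum_i L2_inner (F i) h.
Proof.
elim/big_rec2 : _ => [|i x f _ <-]; first exact: L2_inner0l.
by rewrite L2_innerDl.
Qed.

Lemma L2_inner_eql f g h : L2_eq f g -> L2_inner f h = L2_inner g h.
Proof.
move=> fg; rewrite /L2_inner /Rintegral; congr fine.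
apply: ae_eq_integral => //.
- exact: (measurable_int _ (integrable_L2_mul f h)).
- exact: (measurable_int _ (integrable_L2_mul g h)).
- by apply: filterS fg => x /= -> _.
Qed.

Lemma L2_inner_ge0 f : 0 <= L2_inner f f.
Proof. by apply: Rintegral_ge0 => x _; rewrite -expr2 sqr_ge0. Qed.

Lemma L2_inner_eq0 f : L2_inner f f = 0 -> {ae lebesgue_dom D, forall x, f x = 0}.
Proof.
move=> ff0.
have intff := integrable_L2_mul f f.
have : (\int[lebesgue_dom D]_x `|(f x * f x)%:E| = 0)%E.
  under eq_integral do rewrite gee0_abs ?lee_fin -?expr2 ?sqr_ge0//.
  rewrite -[LHS]fineK; first by rewrite [fine _]ff0.
  exact: integral_fune_fin_num.
move/(ae_eq_integral_abs _ measurableT (measurable_int _ intff)).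
by apply: filterS => x /(_ I) [] /eqP; rewrite mulf_eq0 orbb => /eqP.
Qed.

End L2_theory.

(** * Moments, coefficients and mass matrices *)

Section piecewise_constants.
Context {R : realType} {d : nat} {D : bounded_domain R d}.
Implicit Types (T : triangulation D) (f g : L2 D).

Lemma ThetaD T f g : Theta T f -> Theta T g -> Theta T (f + g).
Proof.
move=> fT gT i; have [a fa] := fT i; have [b gb] := gT i.
exists (a + b); move: fa gb; apply: filterS2 => x fa gb xi.
by rewrite L2_addE fa// gb.
Qed.

Lemma ThetaN T f : Theta T f -> Theta T (- f).
Proof.
move=> fT i; have [a fa] := fT i; exists (- a).
by apply: filterS fa => x fa xi; rewrite L2_oppE fa.
Qed.

Lemma elt_basis_ae T (chi : 'I_(nb_elt T) -> L2 D) : is_elt_basis chi ->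
  exists2 c : 'I_(nb_elt T) -> R, forall i, c i != 0 &
    {ae lebesgue_dom D, forall x i, chi i x = c i * \1_(elt T i) x}.
Proof.
move=> hchi.
have /choice[c hc] : forall i, exists c : R, c != 0 /\
    {ae lebesgue_dom D, forall x, chi i x = c * \1_(elt T i) x}.
  by move=> i; have [c c0 h] := hchi i; exists c.
exists c => [i|]; first by have [] := hc i.
by apply: filter_forall => i; have [] := hc i.
Qed.

Lemma basis_in_Theta T (chi : 'I_(nb_elt T) -> L2 D) i : (0 < d)%N ->
  is_elt_basis chi -> Theta T (chi i).
Proof.
move=> d0 /elt_basis_ae[c _ hc] j; exists (if i == j then c i else 0).
move: (ae_unique_elt T d0) hc; apply: filterS2 => x [k [xk kP]] hc xj.
rewrite hc; case: eqVneq => [->|ij]; first by rewrite indicE mem_set// mulr1.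
rewrite indicE memNset ?mulr0// => xi.
by move: ij; rewrite -(kP _ xi) -(kP _ xj) eqxx.
Qed.

Lemma Theta_span T (chi : 'I_(nb_elt T) -> L2 D) f : (0 < d)%N ->
  is_elt_basis chi -> Theta T f ->
  exists c : 'rV_(nb_elt T), L2_eq f (\sum_i c ord0 i *: chi i).
Proof.
move=> d0 /elt_basis_ae[c c0 hc] /choice[a fa].
exists (\row_i (a i / c i)).
have {fa} : {ae lebesgue_dom D, forall x i, elt T i x -> f x = a i}.
  exact: filter_forall.
move: (ae_unique_elt T d0) hc; apply: filterS3 => x [k [xk kP]] hc fa.
rewrite (fa _ xk) L2_combinationE (bigD1 k)//= big1 => [|i ik].
  by rewrite mxE hc indicE mem_set// mulr1 divfK// addr0.
rewrite hc indicE memNset ?mulr0// => xi.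
by move: ik; rewrite (kP _ xi) eqxx.
Qed.

Lemma coefP T (chi : 'I_(nb_elt T) -> L2 D) f : (0 < d)%N ->
  is_elt_basis chi -> Theta T f ->
  L2_eq f (\sum_i coef chi f ord0 i *: chi i).
Proof. by move=> d0 hchi /(Theta_span d0 hchi)/getPex. Qed.

Definition moments n (psi : 'I_n -> L2 D) f : 'rV[R]_n :=
  \row_j L2_inner f (psi j).

Definition gram m n (chi : 'I_m -> L2 D) (psi : 'I_n -> L2 D) : 'M[R]_(m, n) :=
  \matrix_(i, j) L2_inner (chi i) (psi j).

Lemma momentsD n (psi : 'I_n -> L2 D) f g :
  moments psi (f + g) = moments psi f + moments psi g.
Proof. by apply/rowP => j; rewrite !mxE L2_innerDl. Qed.

Lemma momentsN n (psi : 'I_n -> L2 D) f : moments psi (- f) = - moments psi f.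
Proof. by apply/rowP => j; rewrite !mxE L2_innerNl. Qed.

Lemma gram_tr m n (chi : 'I_m -> L2 D) (psi : 'I_n -> L2 D) :
  (gram chi psi)^T = gram psi chi.
Proof. by apply/matrixP => i j; rewrite !mxE L2_innerC. Qed.

Lemma moments_combination m n (chi : 'I_m -> L2 D) (psi : 'I_n -> L2 D) f
    (c : 'rV[R]_m) :
  L2_eq f (\sum_i c ord0 i *: chi i) -> moments psi f = c *m gram chi psi.
Proof.
move=> fE; apply/rowP => j; rewrite !mxE (L2_inner_eql _ fE) L2_inner_suml.
by apply: eq_bigr => i _; rewrite mxE L2_innerZl.
Qed.

Lemma mass_mx_quadratic n (chi : 'I_n -> L2 D) (c : 'rV[R]_n) :
  (c *m mass_mx chi *m c^T) ord0 ord0 =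
  L2_inner (\sum_i c ord0 i *: chi i) (\sum_i c ord0 i *: chi i).
Proof.
set f := \sum_i _ *: _.
rewrite -[c *m mass_mx chi](@moments_combination _ _ chi chi f c); last first.
  exact: aeW.
rewrite mxE L2_inner_suml; apply: eq_bigr => i _.
by rewrite L2_innerZl !mxE mulrC L2_innerC.
Qed.

Lemma mass_mx_sym n (chi : 'I_n -> L2 D) : (mass_mx chi)^T = mass_mx chi.
Proof. exact: gram_tr. Qed.

(** If v W = 0 then the combination f of the basis with coefficients v has
(f, f) = v W v^T = 0, so f vanishes almost everywhere; on element i it is a
nonzero multiple of v_i, and that element has positive measure. *)
Lemma mass_mx_unit T (chi : 'I_(nb_elt T) -> L2 D) : (0 < d)%N ->
  is_elt_basis chi -> mass_mx chi \in unitmx.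
Proof.
move=> d0 /elt_basis_ae[c c0 hc].
rewrite -row_free_unit; apply: inj_row_free => v vW0.
have := mass_mx_quadratic chi v; rewrite vW0 mul0mx mxE => /esym/L2_inner_eq0 f0.
apply/rowP => i; rewrite [RHS]mxE; apply: contrapT => /eqP vi0.
have : {ae lebesgue_dom D, forall x, ~ elt T i x}.
  move: (ae_unique_elt T d0) hc f0; apply: filterS3 => x [k [xk kP]] hc.
  rewrite L2_combinationE => f0 xi; move: f0; rewrite (bigD1 i)//= big1 => [|j ji].
    rewrite hc indicE mem_set// mulr1 addr0 => /eqP.
    by rewrite mulf_eq0 (negbTE vi0) (negbTE (c0 i)).
  rewrite hc indicE memNset ?mulr0// => xj.
  by move: ji; rewrite -(kP _ xi) -(kP _ xj) eqxx.
have := lebesgue_dom_elt_gt0 i; rewrite lt0e => /andP[/eqP i0 _] ae0.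
apply: i0; apply: measure_negligible; first exact: measurable_elt.
by apply: negligibleS ae0 => x /= xi /(_ xi).
Qed.

(** With c = a^T W^-1, the quadratic form of W^-1 at a is that of W at c. *)
Lemma invmx_mass_mx_ge0 T (chi : 'I_(nb_elt T) -> L2 D) (a : 'cV[R]_(nb_elt T)) :
  (0 < d)%N -> is_elt_basis chi ->
  0 <= (a^T *m invmx (mass_mx chi) *m a) ord0 ord0.
Proof.
move=> d0 hchi; have Wu := mass_mx_unit d0 hchi.
have -> : a^T *m invmx (mass_mx chi) *m a =
    (a^T *m invmx (mass_mx chi)) *m mass_mx chi *m
    (a^T *m invmx (mass_mx chi))^T.
  by rewrite mulmxKV// trmx_mul trmxK trmx_inv mass_mx_sym mulmxA.
by rewrite mass_mx_quadratic L2_inner_ge0.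
Qed.

Lemma moments_coef T (chi : 'I_(nb_elt T) -> L2 D) n (psi : 'I_n -> L2 D) f :
  (0 < d)%N -> is_elt_basis chi -> Theta T f ->
  moments psi f = coef chi f *m gram chi psi.
Proof. by move=> d0 hchi fT; apply: moments_combination; exact: coefP. Qed.

Lemma coefE T (chi : 'I_(nb_elt T) -> L2 D) f : (0 < d)%N ->
  is_elt_basis chi -> Theta T f ->
  coef chi f = moments chi f *m invmx (mass_mx chi).
Proof.
move=> d0 hchi fT; rewrite (moments_coef _ d0 hchi fT).
by rewrite mulmxK// mass_mx_unit.
Qed.

(** Q f has the same moments as f against the basis of its own space, and these
determine its coefficients. *)
Lemma moments_L2_projection T (Q : L2 D -> L2 D) (chi : 'I_(nb_elt T) -> L2 D)
    n (psi : 'I_n -> L2 D) f :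
  (0 < d)%N -> is_elt_basis chi -> is_L2_projection T Q ->
  moments psi (Q f) = moments chi f *m invmx (mass_mx chi) *m gram chi psi.
Proof.
move=> d0 hchi QT; have [QfT Qorth] := QT f.
rewrite (moments_coef _ d0 hchi QfT) (coefE d0 hchi QfT); congr (_ *m _ *m _).
apply/rowP => i; rewrite !mxE; apply/esym/eqP; rewrite -subr_eq0.
by rewrite -L2_innerNl -L2_innerDl Qorth//; exact: basis_in_Theta.
Qed.

(** Row i of [gram chiH chih *m invmx (mass_mx chih)] holds the fine coefficients
of the coarse basis function i, which lies in the fine space. *)
Lemma mass_mx_nested (Th TH : triangulation D)
    (chih : 'I_(nb_elt Th) -> L2 D) (chiH : 'I_(nb_elt TH) -> L2 D) :
  (0 < d)%N -> is_elt_basis chih -> is_elt_basis chiH ->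
  Theta TH `<=` Theta Th ->
  gram chiH chih *m invmx (mass_mx chih) *m gram chih chiH = mass_mx chiH.
Proof.
move=> d0 hh hH nested; apply/row_matrixP => i.
have Ti : Theta Th (chiH i) by apply: nested; exact: basis_in_Theta.
rewrite -mulmxA row_mul mulmxA.
have -> : row i (gram chiH chih) = moments chih (chiH i).
  by apply/rowP => j; rewrite !mxE.
rewrite -(coefE d0 hh Ti) -(moments_coef _ d0 hh Ti).
by apply/rowP => j; rewrite !mxE.
Qed.

End piecewise_constants.

(** K = G^T WH^-1 G satisfies K Wh^-1 K = K, so the second summand is Wh - K;
K Wh^-1 is the matrix of the orthogonal projection in fine coordinates. *)
Lemma covariance_identity (F : fieldType) m n (WH : 'M[F]_m) (Wh : 'M[F]_n)
    (G : 'M[F]_(m, n)) :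
  Wh \in unitmx -> WH \in unitmx -> Wh^T = Wh -> WH^T = WH ->
  G *m invmx Wh *m G^T = WH ->
  G^T *m invmx WH *m G +
  (Wh - G^T *m invmx WH *m G)^T *m invmx Wh *m (Wh - G^T *m invmx WH *m G) = Wh.
Proof.
move=> Whu WHu Whs WHs GG; set K := G^T *m invmx WH *m G.
have KT : K^T = K by rewrite !trmx_mul trmxK trmx_inv WHs mulmxA.
have KK : K *m invmx Wh *m K = K.
  rewrite {2}/K !mulmxA -(mulmxA (G^T *m invmx WH) G) -(mulmxA _ (G *m _) G^T).
  by rewrite GG -(mulmxA G^T) mulVmx// mulmx1.
have BT : (Wh - K)^T = Wh - K by rewrite [LHS]linearB /= Whs KT.
rewrite BT mulmxBl mulmxV// mulmxBl mul1mx mulmxBr KK mulmxKV//.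
by rewrite subrr subr0 addrCA subrr addr0.
Qed.

(** * The two-level representation of white noise *)

Theorem lemma3p2 (R : realType) (d : nat) (hd : d = 2%N \/ d = 3%N)
    (D : bounded_domain R d) (Th TH : triangulation D)
    (chih : 'I_(nb_elt Th) -> L2 D) (chiH : 'I_(nb_elt TH) -> L2 D)
    (hchih : is_elt_basis chih) (hchiH : is_elt_basis chiH)
    (hnested : Theta TH `<=` Theta Th)
    (QH : L2 D -> L2 D) (hQH : is_L2_projection TH QH)
    (dO : measure_display) (Omega : measurableType dO) (P : probability Omega R)
    (zetaH zetah : Omega -> L2 D)
    (hzetaH : white_noise_repr P chiH zetaH)
    (hcoefH : gaussian_vector P (coef chiH \o zetaH) 0 (invmx (mass_mx chiH)))
    (hzetah : white_noise_repr P chih zetah)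
    (hcoefh : gaussian_vector P (coef chih \o zetah) 0 (invmx (mass_mx chih)))
    (hindep : independent_vectors P (coef chiH \o zetaH) (coef chih \o zetah)) :
  let zeta' : Omega -> L2 D := fun w => zetaH w + (zetah w - QH (zetah w)) in
  white_noise_repr P chih zeta' /\
  gaussian_vector P (coef chih \o zeta') 0 (invmx (mass_mx chih)).
Proof.
move=> zeta'; have d0 : (0 < d)%N by case: hd => ->.
have [zHT _] := hzetaH; have [zhT _] := hzetah.
have zT w : Theta Th (zeta' w).
  apply: ThetaD; first exact/hnested/zHT.
  apply: ThetaD => //; apply: ThetaN; apply: hnested.
  by have [] := hQH (zetah w).
have Whu := mass_mx_unit d0 hchih; have WHu := mass_mx_unit d0 hchiH.
pose G := gram chiH chih.
pose K := G^T *m invmx (mass_mx chiH) *m G.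
have momentsE w : moments chih (zeta' w) =
    coef chiH (zetaH w) *m G + coef chih (zetah w) *m (mass_mx chih - K).
  rewrite !momentsD momentsN (moments_coef _ d0 hchiH (zHT w)).
  rewrite (moments_L2_projection _ _ d0 hchiH hQH).
  rewrite !(moments_coef _ d0 hchih (zhT w)) -(gram_tr chiH chih).
  by rewrite mulmxBr /K !mulmxA.
have gauss : gaussian_vector P (fun w => moments chih (zeta' w)) 0 (mass_mx chih).
  have cov := covariance_identity Whu WHu (mass_mx_sym chih) (mass_mx_sym chiH)
    (etrans (congr1 _ (gram_tr chiH chih)) (mass_mx_nested d0 hchih hchiH hnested)).
  rewrite (funext momentsE) -[X in gaussian_vector _ _ _ X]cov.
  apply: (gaussian_vectorD_independent G (mass_mx chih - K) _ _
    hcoefH hcoefh hindep) => a; first exact: invmx_mass_mx_ge0.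
  exact: invmx_mass_mx_ge0.
split; first by split.
have -> : coef chih \o zeta' =
    (fun w => moments chih (zeta' w) *m invmx (mass_mx chih)).
  by apply/funext => w; rewrite /= coefE.
have cov : (invmx (mass_mx chih))^T *m mass_mx chih *m invmx (mass_mx chih) =
    invmx (mass_mx chih).
  by rewrite trmx_inv mass_mx_sym mulVmx// mul1mx.
rewrite -[X in gaussian_vector _ _ _ X]cov.
exact: gaussian_vector_mulmx gauss.
Qed.
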